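(* Let $m_1, m_2, n$ be positive integers and let $\ell$ be any integer. Let $\hat{Q}_3(m_1,-m_2,n,\ell)$ be the knot or link obtained as the closure of the $3$-strand braid $(\sigma_1^{m_1}\sigma_2^{-m_2})^n(\sigma_1\sigma_2)^{3\ell}$. Then its determinant is $$\det\big(\hat{Q}_3(m_1,-m_2,n,\ell)\big) = \left\vert \left(\frac{2 + m_1m_2 + \sqrt{m_1^2m_2^2+4m_1m_2}}{2}\right)^n + \left(\frac{2 + m_1m_2 - \sqrt{m_1^2m_2^2+4m_1m_2}}{2}\right)^n + (-1)^{\ell+1}\,2 \right\vert.$$
   Context: $B_3 = \langle \sigma_1,\sigma_2 \mid \sigma_1\sigma_2\sigma_1 = \sigma_2\sigma_1\sigma_2\rangle$ is the Artin braid group on $3$ strands, with $\sigma_1,\sigma_2$ the standard generators; the closure of a braid $\beta\in B_3$ is the knot or link formed by closing $\beta$ in the usual way. For a knot or link $K$, its determinant is $\det(K) = \vert\Delta_K(-1)\vert$, where $\Delta_K(t)$ is the (one-variable) Alexander polynomial of $K$, defined up to multiplication by $\pm t^k$, $k\in\mathbb{Z}$. The link $\hat{Q}_3(m_1,-m_2,n,\ell)$ is called a twisted generalized hybrid weaving knot. *)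

(* Defs.v *)
From mathcomp Require Import all_boot all_order all_algebra.
From mathcomp Require Import classical_sets reals.
Set Implicit Arguments.
Unset Strict Implicit.
Unset Printing Implicit Defensive.
Import Order.TTheory GRing.Theory Num.Theory.
Local Open Scope ring_scope.

(* Knots and links are given by oriented diagrams, and the Alexander          *)
(* polynomial is computed from the Wirtinger presentation of the link group   *)
(* by Fox calculus. An element of B_3 is a word in the generators, taken up   *)
(* to the congruence braid_eq.                                                *)

Inductive sigma : Type := sigma1 | sigma2.

(* (s, true) is the generator s, (s, false) its inverse. *)
Definition letter : Type := (sigma * bool)%type.
Definition braid_word : Type := seq letter.

Definition gen (s : sigma) : braid_word := [:: (s, true)].

Definition winv (w : braid_word) : braid_word :=
  rev [seq (x.1, ~~ x.2) | x <- w].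

Definition wexp (w : braid_word) (z : int) : braid_word :=
  match z with
  | Posz k => flatten (nseq k w)
  | Negz k => flatten (nseq k.+1 (winv w))
  end.

Inductive braid_eq : braid_word -> braid_word -> Prop :=
| braid_eq_refl w : braid_eq w w
| braid_eq_sym w1 w2 : braid_eq w1 w2 -> braid_eq w2 w1
| braid_eq_trans w1 w2 w3 :
    braid_eq w1 w2 -> braid_eq w2 w3 -> braid_eq w1 w3
| braid_eq_cancel u s e v :
    braid_eq (u ++ [:: (s, e); (s, ~~ e)] ++ v) (u ++ v)
| braid_eq_artin u v :
    braid_eq (u ++ (gen sigma1 ++ gen sigma2 ++ gen sigma1) ++ v)
             (u ++ (gen sigma2 ++ gen sigma1 ++ gen sigma2) ++ v).

(* The braid (sigma1^a sigma2^b)^n (sigma1 sigma2)^(3 l). *)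
Definition twisted_hybrid_weaving_braid (a b : int) (n : nat) (l : int) :
    braid_word :=
  wexp (wexp (gen sigma1) a ++ wexp (gen sigma2) b) n%:Z
  ++ wexp (gen sigma1 ++ gen sigma2) (3 * l).

(* An oriented link diagram is cut into segments numbered 0, ..., segments-1. *)
(* At a crossing the under-strand enters along the segment [uin] and leaves   *)
(* along [uout], passing below the segment [over]; the over-strand is not     *)
(* interrupted. A joint is a point at which the segment [a] is continued by   *)
(* the segment [b], away from the crossings.                                  *)
Inductive node : Type :=
| Crossing (positive : bool) (over uin uout : nat)
| Joint (a b : nat).

Record diagram : Type := Diagram { segments : nat; nodes : seq node }.

(* Closure of a braid word: segment 3 * j + p is the strand in position       *)
(* p = 0, 1, 2 just above the j-th letter, with strands oriented downwards.   *)
(* In sigma_i the strand in position i-1 passes over the one in position i    *)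
(* (the opposite convention gives the mirror image of the link). The segments *)
(* below the last letter are joined to those above the first one.             *)
Definition seg (j p : nat) : nat := (3 * j + p)%N.

Definition letter_nodes (j : nat) (x : letter) : seq node :=
  let i := if x.1 is sigma1 then 0%N else 1%N in
  let idle := if x.1 is sigma1 then 2%N else 0%N in
  (if x.2 then
     [:: Joint (seg j i) (seg j.+1 i.+1);
         Crossing true (seg j i) (seg j i.+1) (seg j.+1 i)]
   else
     [:: Joint (seg j i.+1) (seg j.+1 i);
         Crossing false (seg j i.+1) (seg j i) (seg j.+1 i.+1)])
  ++ [:: Joint (seg j idle) (seg j.+1 idle)].

Fixpoint closure_nodes (j : nat) (w : braid_word) : seq node :=
  match w with
  | [::] => [seq Joint (seg j p) (seg 0 p) | p <- iota 0 3]
  | x :: w' => letter_nodes j x ++ closure_nodes j.+1 w'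
  end.

Definition braid_closure (w : braid_word) : diagram :=
  Diagram (3 * (size w).+1) (closure_nodes 0 w).

(* Wirtinger relations, as pairs (u, v) of positive words in the meridians of *)
(* the segments standing for the relation u = v.                              *)
Definition wirtinger (x : node) : seq nat * seq nat :=
  match x with
  | Crossing true y a b => ([:: b; y], [:: y; a])
  | Crossing false y a b => ([:: y; b], [:: a; y])
  | Joint a b => ([:: a], [:: b])
  end.

(* Image in Z[t] of the Fox derivative of the positive word [u] with respect  *)
(* to the generator [g], every meridian being sent to t.                      *)
Definition fox (u : seq nat) (g : nat) : {poly int} :=
  \sum_(k < size u | nth 0%N u k == g) 'X^k.

(* The row of a relation u = v is the Fox derivative of u * v^-1, which       *)
(* equals that of u minus that of v in the group ring of the link group.      *)
Definition alexander_matrix (L : diagram) :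
    'M[{poly int}]_(size (nodes L), segments L) :=
  \matrix_(r, g)
    let uv := wirtinger (nth (Joint 0 0) (nodes L) r) in
    fox uv.1 g - fox uv.2 g.

(* Divisibility in Z[t, t^-1], for elements of Z[t]. *)
Definition laurent_dvd (p q : {poly int}) : Prop :=
  exists (k : nat) (c : {poly int}), 'X^k * q = c * p.

(* The minors generating the first elementary ideal. *)
Definition first_minor (L : diagram) (m : {poly int}) : Prop :=
  exists (f : 'I_(segments L).-1 -> 'I_(size (nodes L)))
         (g : 'I_(segments L).-1 -> 'I_(segments L)),
    m = \det (mxsub f g (alexander_matrix L)).

(* The Alexander polynomial is a greatest common divisor in Z[t, t^-1] of     *)
(* these minors; it is determined up to a unit +- t^k.                        *)
Definition is_alexander_poly (L : diagram) (D : {poly int}) : Prop :=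
  (forall m, first_minor L m -> laurent_dvd D m) /\
  (forall d, (forall m, first_minor L m -> laurent_dvd d m) ->
     laurent_dvd d D).

(* A chosen representative in Z[t]; a gcd always exists as Z[t, t^-1] is      *)
(* a unique factorization domain, so the default 0 plays no role.             *)
Definition alexander_poly (L : diagram) : {poly int} :=
  xget 0 [set D | is_alexander_poly L D]%classic.

Definition link_det (L : diagram) : nat := `|(alexander_poly L).[-1]|%N.

(* Main.v *)
Require Import Defs.
From mathcomp Require Import all_boot all_order all_fingroup all_algebra.
From mathcomp Require Import classical_sets reals.
From mathcomp Require Import ring zify.
Import Order.TTheory GRing.Theory Num.Theory.
Set Implicit Arguments.
Unset Strict Implicit.
Unset Printing Implicit Defensive.
Local Open Scope ring_scope.

(* The rows of the Alexander matrix of a closed 3-braid sum to zero, and so do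
   its columns once the rows are weighted by suitable units +- t^k. Hence all
   its first minors agree up to units, any one of them is the Alexander
   polynomial, and the determinant of the link is that minor at t = -1. There
   the letters give a triangular block with diagonal entries +- 1; eliminating
   it by means of Fox colourings leaves the 2 x 2 determinant
   det (psi - 1) = 2 - tr psi, where psi in SL_2(Z) is the image of the braid
   under the reduced Burau representation at t = -1. This image depends only on
   the braid; for the braid in question it is (-1)^l G^n with det G = 1 and
   tr G = 2 + m1 m2, and the two bases of the powers in the formula are the
   eigenvalues of G. *)

(** * First minors *)

Section Minors.

Variables (R : idomainType) (n : nat) (A : 'M[R]_n.+1).

(** Replace row [i] by the difference of two unit rows. The new matrix [B] still kills the all-ones
    vector, so it is singular, and expanding [\det B] along row [i] gives the difference of the two
    cofactors. *)
Lemma cofactor_col_indep i j j' :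
  A *m const_mx 1 = 0 :> 'cV_n.+1 -> cofactor A i j = cofactor A i j'.
Proof.
move=> A1.
pose B := \matrix_(k, l) if k == i then (l == j)%:R - (l == j')%:R else A k l.
have cofB l : cofactor B i l = cofactor A i l.
  rewrite /cofactor; congr (_ * \det _); apply/matrixP=> a b.
  by rewrite !mxE eq_sym (negbTE (neq_lift _ _)).
have sumd (F : 'I_n.+1 -> R) k : \sum_l (l == k)%:R * F l = F k.
  rewrite (bigD1 k) //= eqxx mul1r big1 ?addr0 // => l /negbTE->.
  by rewrite mul0r.
have detB : \det B = cofactor A i j - cofactor A i j'.
  rewrite (expand_det_row _ i).
  under eq_bigr do rewrite cofB mxE eqxx mulrBl.
  by rewrite sumrB !sumd.
have B1 : B *m const_mx 1 = 0 :> 'cV_n.+1.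
  apply/matrixP=> k z; rewrite !mxE.
  have [->|ki] := eqVneq k i.
    under eq_bigr do rewrite !mxE eqxx mulrBl.
    by rewrite sumrB !(sumd (fun=> 1)) subrr.
  under eq_bigr do rewrite mxE (negbTE ki).
  by move/matrixP: A1 => /(_ k z); rewrite !mxE.
apply/eqP; rewrite -subr_eq0 -detB; apply/eqP.
have : \adj B *m (B *m const_mx 1) = 0 :> 'cV_n.+1 by rewrite B1 mulmx0.
rewrite mulmxA mul_adj_mx mul_scalar_mx => /matrixP/(_ ord0 ord0).
by rewrite !mxE mulr1.
Qed.

(** Dual argument: column [j] is replaced by a combination of two unit columns that [v] annihilates.
    As [v] is nonzero at [i], the new matrix is singular. *)
Lemma cofactor_row_weight (v : 'rV[R]_n.+1) i i' j :
  v *m A = 0 -> v 0 i != 0 -> v 0 i' * cofactor A i j = v 0 i * cofactor A i' j.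
Proof.
move=> vA vi.
pose B := \matrix_(k, l) if l == j then v 0 i' * (k == i)%:R - v 0 i * (k == i')%:R
                         else A k l.
have cofB k : cofactor B k j = cofactor A k j.
  rewrite /cofactor; congr (_ * \det _); apply/matrixP=> a b.
  by rewrite !mxE eq_sym (negbTE (neq_lift _ _)).
have sumd (F : 'I_n.+1 -> R) k : \sum_l F l * (l == k)%:R = F k.
  rewrite (bigD1 k) //= eqxx mulr1 big1 ?addr0 // => l /negbTE->.
  by rewrite mulr0.
have detB : \det B = v 0 i' * cofactor A i j - v 0 i * cofactor A i' j.
  rewrite (expand_det_col _ j).
  under eq_bigr do rewrite cofB mxE eqxx mulrBl -!mulrA ![_%:R * _]mulrC.
  by rewrite sumrB -!mulr_sumr !sumd.
have vB : v *m B = 0.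
  apply/matrixP=> z k; rewrite !mxE ord1.
  have [->|kj] := eqVneq k j.
    under eq_bigr => l _.
      rewrite mxE eqxx mulrBr (mulrCA (v 0 l) (v 0 i')) (mulrCA (v 0 l) (v 0 i)).
      over.
    by rewrite sumrB -!mulr_sumr !(sumd (v 0)) mulrC subrr.
  under eq_bigr do rewrite mxE (negbTE kj).
  by move/matrixP: vA => /(_ 0 k); rewrite !mxE.
apply/eqP; rewrite -subr_eq0 -detB.
have : (v *m B) *m \adj B = 0 by rewrite vB mul0mx.
rewrite -mulmxA mul_mx_adj mul_mx_scalar => /matrixP/(_ ord0 i)/eqP.
by rewrite !mxE mulf_eq0 (negbTE vi) orbF.
Qed.

End Minors.

(** By counting, [f] misses some value [i]; undoing [lift i] leaves an injective self-map of a
    finite set. *)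
Lemma inj_lift_perm n (f : 'I_n -> 'I_n.+1) :
  injective f -> exists (i : 'I_n.+1) (s : 'S_n), forall k, f k = lift i (s k).
Proof.
move=> f_inj.
have [i iNf] : exists i, i \notin codom f.
  apply/existsP; rewrite -negb_forall; apply/negP => /forallP sf.
  have /subset_leq_card : 'I_n.+1 \subset codom f by apply/fintype.subsetP=> i _.
  by rewrite card_codom // !card_ord ltnn.
have P k : {l | f k = lift i l}.
  case: (@unlift_some _ i (f k)) => [|l -> _]; last by exists l.
  by apply: contraNneq iNf => ->; exact: codom_f.
have s_inj : injective (fun k => sval (P k)).
  by move=> k l /(congr1 (lift i)); case: (P k) (P l) => ? /= <- [? /= <-] /f_inj.
by exists i, (perm s_inj) => k /=; rewrite permE; case: (P k).
Qed.

Lemma det_mxsub_perm (R : comNzRingType) n (A : 'M[R]_n.+1) (f g : 'I_n -> 'I_n.+1) (i j : 'I_n.+1)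
    (s t : 'S_n) :
  (forall k, f k = lift i (s k)) -> (forall k, g k = lift j (t k)) ->
  exists e : bool, \det (mxsub f g A) = (-1) ^+ e * cofactor A i j.
Proof.
move=> fE gE.
have -> : mxsub f g A = row_perm s (col_perm t (row' i (col' j A))).
  by apply/matrixP=> a b; rewrite !mxE fE gE.
exists (odd_perm s (+) odd_perm t (+) odd (i + j)).
rewrite row_permE col_permE !det_mulmx !det_perm odd_permV /cofactor.
rewrite -[(-1) ^+ (i + j)]signr_odd !signr_addb.
rewrite -!mulrA signrMK; congr (_ * (_ * _)).
by rewrite mulrC -mulrA.
Qed.

Lemma det_mxsub_noninj (R : comNzRingType) n m (A : 'M[R]_m) (f g : 'I_n -> 'I_m) :
  ~~ (injectiveb f && injectiveb g) -> \det (mxsub f g A) = 0.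
Proof.
rewrite negb_and => /orP[]/injectivePn[a [b ab fab]].
  by apply: (determinant_alternate ab) => j; rewrite !mxE fab.
rewrite -det_tr; apply: (determinant_alternate ab) => j.
by rewrite !mxE fab.
Qed.

(** The unit ['X^k] takes the value +-1 at -1, so it disappears from absolute values. *)
Lemma laurent_dvd_eval p q : laurent_dvd p q -> (`|p.[-1]| %| `|q.[-1]|)%N.
Proof.
move=> [k [c /(congr1 (fun r : {poly int} => `|r.[-1]|%N))]].
rewrite !hornerM hornerXn !abszM abszX exp1n mul1n => ->.
exact: dvdn_mull.
Qed.

Lemma link_det_eval L D : is_alexander_poly L D -> link_det L = `|D.[-1]|%N.
Proof.
move=> LD; have [mL gL] : is_alexander_poly L (alexander_poly L).
  by apply: (@xgetPex _ 0 [set D | is_alexander_poly L D]%classic); exists D.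
have [mD gD] := LD.
apply/eqP; rewrite eqn_dvd; apply/andP; split; apply: laurent_dvd_eval.
  exact: gD.
exact: gL.
Qed.

Definition fox_row (x : node) (g : nat) : {poly int} :=
  fox (wirtinger x).1 g - fox (wirtinger x).2 g.

Lemma first_minorE L n (A := \matrix_(r < n.+1, g < n.+1)
      fox_row (nth (Joint 0 0) (nodes L) r) g) m :
  size (nodes L) = n.+1 -> segments L = n.+1 ->
  first_minor L m <-> exists f g : 'I_n -> 'I_n.+1, m = \det (mxsub f g A).
Proof.
(* With entries given by a function on natural numbers, the sizes occur only in the index types and
   can be rewritten. *)
pose F i j := fox_row (nth (Joint 0 0) (nodes L) i) j.
have minorE k k' h h' : mxsub h h' (alexander_matrix L) =
    \matrix_(i < k, j < k') F (h i) (h' j) by apply/matrixP=> i j; rewrite !mxE.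
have minorE' h h' : mxsub h h' A = \matrix_(i < n, j < n) F (h i) (h' j).
  by apply/matrixP=> i j; rewrite !mxE.
rewrite /first_minor => sz sg.
have -> : (exists (f : 'I_(segments L).-1 -> 'I_(size (nodes L)))
                 (g : 'I_(segments L).-1 -> 'I_(segments L)),
    m = \det (mxsub f g (alexander_matrix L))) <->
  (exists (f : 'I_(segments L).-1 -> 'I_(size (nodes L)))
                 (g : 'I_(segments L).-1 -> 'I_(segments L)),
    m = \det (\matrix_(i, j) F (f i) (g j))).
  by split=> -[f [g ->]]; exists f, g; rewrite minorE.
clearbody F; rewrite sz sg.
by split=> -[f [g ->]]; exists f, g; rewrite minorE'.
Qed.

(** The row [i0] omitted by [f0] has the unit weight [- 'X^k]. Comparing cofactors, ['X^k] times any
    first minor is a multiple of the chosen one, which is therefore a gcd of all of them. *)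
Lemma is_alexander_minor L n (A := \matrix_(r < n.+1, g < n.+1)
      fox_row (nth (Joint 0 0) (nodes L) r) g)
    (v : 'rV_n.+1) (i0 : 'I_n.+1) k (f0 g0 : 'I_n -> 'I_n.+1) :
  size (nodes L) = n.+1 -> segments L = n.+1 ->
  A *m const_mx 1 = 0 :> 'cV_n.+1 -> v *m A = 0 -> v 0 i0 = - 'X^k ->
  injective f0 -> injective g0 -> (forall r, f0 r != i0) ->
  is_alexander_poly L (\det (mxsub f0 g0 A)).
Proof.
move=> sz sg A1 vA vi f0_inj g0_inj f0i; split=> [m|d]; last first.
  by apply; apply/(first_minorE _ sz sg); exists f0, g0.
move=> /(first_minorE _ sz sg)[f [g ->]]; rewrite -/A.
have [/andP[/injectiveP f_inj /injectiveP g_inj]|/det_mxsub_noninj->] :=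
    boolP (injectiveb f && injectiveb g); last first.
  by exists 0%N, 0; rewrite mulr0 mul0r.
have [i [s fE]] := inj_lift_perm f_inj.
have [j [t gE]] := inj_lift_perm g_inj.
have [i1 [s0 f0E]] := inj_lift_perm f0_inj.
have [j0 [t0 g0E]] := inj_lift_perm g0_inj.
have {i1 f0E} f0E r : f0 r = lift i0 (s0 r).
  rewrite f0E; congr lift; apply/eqP; apply/negPn/negP.
  move=> i01; case: (unlift_some i01) => r' r'E _.
  by have := f0i (s0^-1%g r'); rewrite f0E permKV -r'E eqxx.
have [e ->] := det_mxsub_perm A fE gE.
have [e0 ->] := det_mxsub_perm A f0E g0E.
have vi0 : v 0 i0 != 0 by rewrite vi oppr_eq0 monic_neq0 ?monicXn.
(* The two signs come from sorting rows and columns of both minors, the leading minus from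
   [v 0 i0 = - 'X^k]. *)
exists k, (- (-1) ^+ e * (-1) ^+ e0 * v 0 i).
have -> : 'X^k = - v 0 i0 by rewrite vi opprK.
rewrite [LHS]mulrCA [in LHS]mulNr -(cofactor_row_weight i j vA vi0).
rewrite (cofactor_col_indep i0 j j0 A1) !mulNr mulrN; congr (- _).
by rewrite -!mulrA; congr (_ * _); rewrite [RHS]mulrCA signrMK.
Qed.

(** * The Alexander matrix of a closed braid *)

Definition out (x : node) : nat :=
  match x with Crossing _ _ _ b => b | Joint _ b => b end.

Definition ins (x : node) : seq nat :=
  match x with Crossing _ y a _ => [:: y; a] | Joint a _ => [:: a] end.

(** The Fox row as a linear form on colourings of the segments. Its vanishing is the Alexander
    quandle rule: [c b = (1 - t) c y + t c a] at a positive crossing, the inverse rule at a negative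
    one. *)
Definition fox_coef (x : node) (c : nat -> {poly int}) : {poly int} :=
  match x with
  | Crossing true y a b => c b - c y + 'X * (c y - c a)
  | Crossing false y a b => c y - c a + 'X * (c b - c y)
  | Joint a b => c a - c b
  end.

Lemma fox1 a g : fox [:: a] g = (a == g)%:R.
Proof. by rewrite /fox big_mkcond big_ord_recl big_ord0 /= addr0; case: eqP. Qed.

Lemma fox2 a b g : fox [:: a; b] g = (a == g)%:R + 'X * (b == g)%:R.
Proof.
rewrite /fox big_mkcond !big_ord_recl big_ord0 /= addr0.
by do 2!case: eqP; rewrite ?mulr1 ?mulr0.
Qed.

Lemma fox_rowE x g : fox_row x g = fox_coef x (fun a => (a == g)%:R).
Proof.
rewrite /fox_row; case: x => [[] y a b|a b]; rewrite /= ?fox1 // !fox2; ring.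
Qed.

Lemma fox_row_sum (r : seq nat) (c : nat -> {poly int}) x :
  uniq r -> all (mem r) (out x :: ins x) ->
  \sum_(g <- r) fox_row x g * c g = fox_coef x c.
Proof.
move=> ur.
have sumd a : a \in r -> \sum_(g <- r) (a == g)%:R * c g = c a.
  move=> ar; rewrite (bigD1_seq a) //= eqxx mul1r big1 ?addr0 // => g ga.
  by rewrite eq_sym (negbTE ga) mul0r.
under eq_bigr do rewrite fox_rowE.
case: x => [[] y a b|a b] /=.
- move=> /and4P[rb ry ra _]; rewrite -(sumd _ rb) -(sumd _ ry) -(sumd _ ra).
  rewrite -!sumrB mulr_sumr -big_split; apply: eq_bigr => g _ /=; ring.
- move=> /and4P[rb ry ra _]; rewrite -(sumd _ rb) -(sumd _ ry) -(sumd _ ra).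
  rewrite -!sumrB mulr_sumr -big_split; apply: eq_bigr => g _ /=; ring.
move=> /and3P[rb ra _]; rewrite -(sumd _ rb) -(sumd _ ra).
rewrite -!sumrB; apply: eq_bigr => g _ /=; ring.
Qed.

Fixpoint word_nodes (j : nat) (w : braid_word) : seq node :=
  if w is x :: w' then letter_nodes j x ++ word_nodes j.+1 w' else [::].

Definition final_nodes (j : nat) : seq node :=
  [:: Joint (seg j 0) (seg 0 0); Joint (seg j 1) (seg 0 1); Joint (seg j 2) (seg 0 2)].

Lemma closure_nodesE j w :
  closure_nodes j w = word_nodes j w ++ final_nodes (j + size w).
Proof.
elim: w j => [|x w IH] j; first by rewrite /= addn0.
by rewrite /= IH catA addnS.
Qed.

Lemma size_word_nodes j w : size (word_nodes j w) = (3 * size w)%N.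
Proof.
by elim: w j => [|[[] []] w IH] j //=; rewrite IH; lia.
Qed.

(* The relations weighted by these units add up to zero: strand p carries t^p,
   which is the left fixed vector (1, t, t^2) of the Burau matrices. *)
Definition weight (x : node) : {poly int} :=
  match x with
  | Crossing true _ _ b => 'X^(b %% 3)
  | Crossing false _ a _ => 'X^(a %% 3)
  | Joint _ b => - 'X^(b %% 3)
  end.

Definition level_sum (j g : nat) : {poly int} :=
  (seg j 0 == g)%:R + 'X * (seg j 1 == g)%:R + 'X^2 * (seg j 2 == g)%:R.

Lemma seg_mod j p : (p < 3)%N -> (seg j p %% 3 = p)%N.
Proof. by rewrite /seg => p3; lia. Qed.

(** Telescoping: the weighted rows of one letter add up to the difference of the level sums below
    and above it. The final joints later lead back to level 0. *)
Lemma weight_word_nodes j w g :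
  \sum_(x <- word_nodes j w) weight x * fox_row x g =
  level_sum (j + size w) g - level_sum j g.
Proof.
elim: w j => [|x w IH] j; first by rewrite big_nil addn0 subrr.
rewrite /= big_cat /= IH addnS addSn /level_sum.
by case: x => [[] []] /=; rewrite ?big_cons big_nil !fox_rowE /= ?seg_mod //=;
  rewrite ?expr0 ?expr1; ring.
Qed.

Lemma weight_closure_nodes w g :
  \sum_(x <- closure_nodes 0 w) weight x * fox_row x g = 0.
Proof.
rewrite closure_nodesE big_cat /= weight_word_nodes add0n /level_sum.
by rewrite ?big_cons big_nil !fox_rowE /= ?seg_mod //= ?expr0 ?expr1; ring.
Qed.

Definition segs (x : node) : seq nat := out x :: ins x.

Lemma letter_nodes_segs j x :
  all (fun nd => all (fun s => 3 * j <= s < 3 * j.+2)%N (segs nd)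
              && (3 * j.+1 <= out nd)%N) (letter_nodes j x).
Proof. by case: x => [[] []] /=; rewrite /seg; lia. Qed.

Lemma word_nodes_segs j w :
  all (fun nd => all (fun s => 3 * j <= s < 3 * (j + size w).+1)%N (segs nd)
              && (3 * j.+1 <= out nd)%N) (word_nodes j w).
Proof.
elim: w j => // x w IH j /=; rewrite all_cat; apply/andP; split.
  by apply: sub_all (letter_nodes_segs j x) => -[? y a b|a b] /=; lia.
by apply: sub_all (IH j.+1) => -[? y a b|a b] /=; lia.
Qed.

Lemma word_nodes_out_ins j w : all (fun nd => out nd \notin ins nd) (word_nodes j w).
Proof.
elim: w j => // x w IH j /=; rewrite all_cat IH andbT.
by case: x => [[] []] /=; rewrite /seg !inE; lia.
Qed.

(** This is what makes the block of the letters lower triangular once columns are indexed by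
    outgoing segments. *)
Lemma word_nodes_pairwise j w :
  pairwise (fun nd nd' => out nd' \notin segs nd) (word_nodes j w).
Proof.
elim: w j => // x w IH j /=; rewrite pairwise_cat IH andbT; apply/andP; split.
  apply: sub_all (letter_nodes_segs j x) => nd /andP[/allP ndj _].
  apply: sub_all (word_nodes_segs j.+1 w) => nd' /andP[_ nd'j].
  by apply/negP => /ndj; lia.
by case: x => [[] []] /=; rewrite /segs /seg /= !inE; lia.
Qed.

Lemma closure_nodes_segs w :
  all (fun nd => all (fun s => s < 3 * (size w).+1)%N (segs nd)) (closure_nodes 0 w).
Proof.
rewrite closure_nodesE all_cat; apply/andP; split.
  apply: sub_all (word_nodes_segs 0 w) => nd /andP[+ _].
  by apply: sub_all => s; lia.
by rewrite /segs /= /seg; lia.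
Qed.

(** The letters produce distinct segments numbered from 3 on, the final joints produce 0, 1, 2, and
    the count matches. Hence nodes can index the columns as well as the rows. *)
Lemma closure_nodes_out w :
  perm_eq [seq out nd | nd <- closure_nodes 0 w] (iota 0 (3 * (size w).+1)).
Proof.
set s := map _ _.
have us : uniq s.
  rewrite /s closure_nodesE map_cat cat_uniq.
  apply/and3P; split=> //.
    rewrite uniq_pairwise pairwise_map.
    apply: sub_pairwise (word_nodes_pairwise 0 w) => a b.
    by rewrite /segs inE negb_or eq_sym => /andP[].
  have /allP s3 : all (fun a => 3 <= a)%N [seq out nd | nd <- word_nodes 0 w].
    by rewrite all_map; apply: sub_all (word_nodes_segs 0 w) => nd /andP[_].
  by apply/hasPn => a /= a3; apply/negP => /s3; move: a3; rewrite /seg !inE; lia.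
have sub_s : {subset s <= iota 0 (3 * (size w).+1)}.
  move: (closure_nodes_segs w); rewrite /s; set M := (3 * _)%N => segsM.
  apply/allP; rewrite all_map; apply: sub_all segsM => nd /andP[ndM _].
  by change (out nd \in iota 0 M); rewrite mem_iota.
have [|_ eq_s] := uniq_min_size us sub_s.
  by rewrite size_map closure_nodesE size_cat size_word_nodes size_iota /= mulnS addnC.
by rewrite uniq_perm ?iota_uniq.
Qed.

(** * The Burau representation and colourings *)

Definition mx2 (a b c d : int) : 'M[int]_2 :=
  \matrix_(i, j) if i == 0 then if j == 0 then a else b
                 else if j == 0 then c else d.

Lemma mx2M a b c d a' b' c' d' :
  mx2 a b c d * mx2 a' b' c' d' =
  mx2 (a * a' + b * c') (a * b' + b * d') (c * a' + d * c') (c * b' + d * d').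
Proof.
apply/matrixP=> i j; rewrite -mulmxE !mxE !big_ord_recl big_ord0 !mxE /= addr0.
by do 2!case: eqP.
Qed.

Lemma mx2_scalar a : a%:M = mx2 a 0 0 a.
Proof.
by apply/matrixP=> -[[|[|//]] ?] -[[|[|//]] ?]; rewrite !mxE.
Qed.

Lemma mx2_1 : 1 = mx2 1 0 0 1.
Proof. exact: mx2_scalar. Qed.

Lemma mx2_eta (A : 'M[int]_2) : A = mx2 (A 0 0) (A 0 1) (A 1 0) (A 1 1).
Proof.
apply/matrixP=> -[[|[|//]] ?] -[[|[|//]] ?]; rewrite !mxE /=;
  congr (A _ _); exact: val_inj.
Qed.

Lemma det_mx2 (A : 'M[int]_2) : \det A = A 0 0 * A 1 1 - A 0 1 * A 1 0.
Proof.
rewrite (expand_det_row _ 0) !big_ord_recl big_ord0 addr0.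
rewrite /cofactor !det_mx11 !mxE /= expr0 expr1 mul1r mulN1r mulrN.
by congr (A _ _ * A _ _ - A _ _ * A _ _); apply: val_inj.
Qed.

Lemma tr_mx2 a b c d : \tr (mx2 a b c d) = a + d.
Proof. by rewrite /mxtrace !big_ord_recl big_ord0 !mxE addr0. Qed.

(* The reduced Burau representation at t = -1, acting on the differences
   (x0 - x1, x1 - x2) of the colours of the strands; letters act from top to
   bottom, hence the reversed products below. *)
Definition burau_letter (x : letter) : 'M[int]_2 :=
  match x with
  | (sigma1, e) => mx2 1 0 (if e then 1 else -1) 1
  | (sigma2, e) => mx2 1 (if e then -1 else 1) 0 1
  end.

Fixpoint burau (w : braid_word) : 'M[int]_2 :=
  if w is x :: w' then burau w' * burau_letter x else 1.

Lemma burau_cat u v : burau (u ++ v) = burau v * burau u.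
Proof. by elim: u => [|x u IH] /=; rewrite ?mulr1 // IH mulrA. Qed.

Lemma burau_letterK x : burau_letter (x.1, ~~ x.2) * burau_letter x = 1.
Proof. by case: x => [[] []]; rewrite /= mx2M mx2_1. Qed.

Lemma burau_eq w w' : braid_eq w w' -> burau w = burau w'.
Proof.
elim=> {w w'} // [w1 w2 w3 _ -> _ -> //|u s e v|u v].
  by rewrite !burau_cat /= mul1r (burau_letterK (s, e)) mulr1.
by rewrite !burau_cat /= !mul1r !mx2M.
Qed.

Lemma det_burau w : \det (burau w) = 1.
Proof.
elim: w => [|x w IH] /=; first exact: det1.
rewrite det_mulmx IH mul1r det_mx2.
by case: x => [[] e]; rewrite /= !mxE /= ?mulr0 ?mul0r mulr1 subr0.
Qed.

(* The relations at t = -1: a Fox colouring by integers. *)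
Definition colours (c : nat -> int) (x : node) : bool :=
  match x with
  | Crossing _ y a b => c b == 2 * c y - c a
  | Joint a b => c b == c a
  end.

(** Colours propagate downwards, each node determining its outgoing colour. The differences follow
    the Burau matrices; the invariant alternating sum is the fixed vector [(1, t, t^2)] at t = -1
    and recovers the colours themselves. *)
Lemma colouring_exists j w (x0 x1 x2 : int) :
  exists c : nat -> int,
    [/\ all (colours c) (word_nodes j w),
        [/\ c (seg j 0) = x0, c (seg j 1) = x1 & c (seg j 2) = x2] &
        let y p := c (seg (j + size w) p) in
        [/\ y 0%N - y 1%N = burau w 0 0 * (x0 - x1) + burau w 0 1 * (x1 - x2),
            y 1%N - y 2%N = burau w 1 0 * (x0 - x1) + burau w 1 1 * (x1 - x2) &
            y 0%N - y 1%N + y 2%N = x0 - x1 + x2]].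
Proof.
elim: w j x0 x1 x2 => [|x w IH] j x0 x1 x2.
  exists (fun s => if s == seg j 0 then x0 else if s == seg j 1 then x1 else x2).
  rewrite /= addn0 mx2_1 !mxE /=.
  have [-> -> ->] : [/\ seg j 1 == seg j 0 = false, seg j 2 == seg j 0 = false
                      & seg j 2 == seg j 1 = false] by rewrite /seg; split; lia.
  by rewrite !eqxx; split=> //; split; ring.
(* Colours just below the letter [x]: the over-strand keeps its colour [y], and the under-strand
   colour [a] becomes [2 * y - a]. *)
pose z p := match x with
  | (sigma1, true) => nth 0 [:: 2 * x0 - x1; x0; x2] p
  | (sigma1, false) => nth 0 [:: x1; 2 * x1 - x0; x2] p
  | (sigma2, true) => nth 0 [:: x0; 2 * x1 - x2; x1] p
  | (sigma2, false) => nth 0 [:: x0; x2; 2 * x2 - x1] p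
  end.
have [c [cw [c0 c1 c2] cy]] := IH j.+1 (z 0%N) (z 1%N) (z 2%N).
(* Prescribing the colours at level [j] does not disturb the nodes of the remaining word, which only
   meet segments from [3 * j.+1] on. *)
pose c' s := if s == seg j 0 then x0 else if s == seg j 1 then x1 else
  if s == seg j 2 then x2 else c s.
have c'E s : (3 * j.+1 <= s)%N -> c' s = c s.
  by rewrite /c' /seg => js; rewrite !ifF //; lia.
have [c'0 c'1 c'2] : [/\ c' (seg j 0) = x0, c' (seg j 1) = x1 & c' (seg j 2) = x2].
  rewrite /c' !eqxx.
  have [-> -> ->] : [/\ seg j 1 == seg j 0 = false, seg j 2 == seg j 0 = false
                      & seg j 2 == seg j 1 = false] by rewrite /seg; split; lia.
  by [].
have c'z p : (p < 3)%N -> c' (seg j.+1 p) = z p.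
  move=> p3; rewrite c'E /seg; last by lia.
  by case: p p3 => [|[|[|]]].
exists c'; split=> //.
  rewrite /= all_cat; apply/andP; split.
    by move: c'z; rewrite /z; case: x {z c0 c1 c2 cy} => [[] []] /= c'z;
      rewrite !c'z // ?c'0 ?c'1 ?c'2 ?eqxx.
  have: all (fun nd => colours c nd && all (fun s => 3 * j.+1 <= s)%N (segs nd))
            (word_nodes j.+1 w).
    rewrite all_predI cw /=; apply: sub_all (word_nodes_segs j.+1 w).
    by move=> nd /andP[+ _]; apply: sub_all => s /andP[].
  apply: sub_all => -[? y a b|a b] /=.
    by move=> /andP[cb /and4P[hb hy ha _]]; rewrite !c'E.
  by move=> /andP[cb /and3P[hb ha _]]; rewrite !c'E.
rewrite /= addnS -addSn !c'E ?/seg; try lia.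
case: cy => /= -> -> ->; rewrite [burau w]mx2_eta.
by rewrite /z; case: x {z c'z c0 c1 c2} => [[] []];
  rewrite /= mx2M !mxE /=; split; ring.
Qed.

(** * Evaluation of the minor *)

(** Multiplying [C] on the right by the unitriangular block matrix with corner [P] clears its upper
    right block and leaves [K] at the lower right. *)
Lemma det_col_elim (R : comNzRingType) a b (C : 'M[R]_(a + b)) P K :
  C *m col_mx P 1%:M = col_mx 0 K -> \det C = \det (ulsubmx C) * \det K.
Proof.
rewrite -{1}[C]submxK mul_block_col !mulmx1 => /eq_col_mx[ulP dlP].
have := mulmx_block (ulsubmx C) (ursubmx C) (dlsubmx C) (drsubmx C) 1%:M P 0 1%:M.
rewrite submxK !mulmx1 !mulmx0 !addr0 ulP dlP => /(congr1 determinant).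
by rewrite det_lblock det_mulmx det_ublock !det1 !mulr1.
Qed.

Lemma fox_row_notin x g : g \notin segs x -> fox_row x g = 0.
Proof.
rewrite fox_rowE.
case: x => [[] y a b|a b]; rewrite /segs !inE /= !negb_or.
- by move=> /and3P[]; rewrite ![g == _]eq_sym => /negbTE-> /negbTE-> /negbTE->; ring.
- by move=> /and3P[]; rewrite ![g == _]eq_sym => /negbTE-> /negbTE-> /negbTE->; ring.
by move=> /andP[]; rewrite ![g == _]eq_sym => /negbTE-> /negbTE->; ring.
Qed.

Lemma fox_row_out x : out x \notin ins x -> `|(fox_row x (out x)).[-1]|%N = 1%N.
Proof.
rewrite fox_rowE.
case: x => [[] y a b|a b]; rewrite !inE /= ?negb_or ![b == _]eq_sym eqxx.
- by move=> /andP[/negbTE-> /negbTE->]; rewrite !hornerE.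
- by move=> /andP[/negbTE-> /negbTE->]; rewrite !hornerE.
by move=> /negbTE->; rewrite !hornerE.
Qed.

Lemma colours_fox_coef (c : nat -> int) x :
  colours c x -> (fox_coef x (fun s => (c s)%:P)).[-1] = 0.
Proof.
by case: x => [[] y a b|a b] /= /eqP->; rewrite !hornerE; ring.
Qed.

Section BraidClosure.

Variable w : braid_word.

Let N := size w.
Let a := (3 * N)%N.
Let nd r := nth (Joint 0 0) (closure_nodes 0 w) r.
Let o r := out (nd r).

(* Columns are listed in the order in which the nodes produce their outgoing
   segments, so that the part coming from the letters is triangular. *)
Definition closure_minor : 'M[{poly int}]_(a + 2) :=
  \matrix_(i, j) fox_row (nd i) (o j).

Let size_nodes : size (closure_nodes 0 w) = (a + 2).+1.
Proof. by rewrite closure_nodesE size_cat size_word_nodes /= addnS. Qed.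

Let aM : (3 * (size w).+1)%N = (a + 2).+1.
Proof. by rewrite /a /N; lia. Qed.

Let all_nd P r : all P (closure_nodes 0 w) -> (r < (a + 2).+1)%N -> P (nd r).
Proof. by move=> allP rM; apply: all_nthP => //; rewrite size_nodes. Qed.

Let nd_word r : (r < a)%N -> nd r = nth (Joint 0 0) (word_nodes 0 w) r.
Proof. by move=> ra; rewrite /nd closure_nodesE nth_cat size_word_nodes ra. Qed.

Let nd_final p : (p < 3)%N -> nd (a + p) = Joint (seg N p) (seg 0 p).
Proof.
move=> p3; rewrite /nd closure_nodesE nth_cat size_word_nodes ltnNge leq_addr /=.
by rewrite -/N -/a addKn; case: p p3 => [|[|[|]]].
Qed.

Let o_lt r : (r < (a + 2).+1)%N -> (o r < (a + 2).+1)%N.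
Proof.
by move=> rM; have := all_nd (closure_nodes_segs w) rM; rewrite aM => /andP[].
Qed.

Let o_inj r s : (r < (a + 2).+1)%N -> (s < (a + 2).+1)%N -> o r = o s -> r = s.
Proof.
rewrite -size_nodes => rM sM /eqP.
rewrite /o /nd -!(nth_map _ 0%N) // nth_uniq ?size_map //; first by move/eqP.
by rewrite (perm_uniq (closure_nodes_out w)) iota_uniq.
Qed.

Let fox_row_sum_out r (c : nat -> {poly int}) : (r < (a + 2).+1)%N ->
  \sum_(i < (a + 2).+1) fox_row (nd r) (o i) * c (o i) = fox_coef (nd r) c.
Proof.
move=> rM; rewrite -(@fox_row_sum (iota 0 (a + 2).+1)) ?iota_uniq //; last first.
  move: (all_nd (closure_nodes_segs w) rM); apply: sub_all => s.
  by rewrite aM => sM; change (s \in iota 0 (a + 2).+1); rewrite mem_iota.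
have:= closure_nodes_out w; rewrite aM => eq_out.
rewrite -(perm_big _ eq_out) /= big_map (big_nth (Joint 0 0)).
by rewrite size_nodes big_mkord.
Qed.

Lemma is_alexander_closure : is_alexander_poly (braid_closure w) (\det closure_minor).
Proof.
pose A := \matrix_(r < (a + 2).+1, g < (a + 2).+1) fox_row (nd r) g.
pose f0 (i : 'I_(a + 2)) : 'I_(a + 2).+1 := widen_ord (leqnSn _) i.
pose g0 (i : 'I_(a + 2)) : 'I_(a + 2).+1 := Ordinal (o_lt (ltn_ord (f0 i))).
have -> : closure_minor = mxsub f0 g0 A by apply/matrixP=> i j; rewrite !mxE.
(* The omitted row is the last joint, of weight [- 'X^2]; the omitted column is its outgoing segment
   [seg 0 2]. *)
apply: (@is_alexander_minor _ _ (\row_r weight (nd r)) ord_max 2 f0 g0).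
- exact: size_nodes.
- exact: aM.
- apply/matrixP=> r z; rewrite !mxE.
  under eq_bigr do rewrite !mxE.
  rewrite -(big_mkord xpredT (fun g => fox_row (nd r) g * 1)).
  rewrite /index_iota subn0 (@fox_row_sum _ (fun=> 1)) ?iota_uniq //; last first.
    move: (all_nd (closure_nodes_segs w) (ltn_ord r)); apply: sub_all => s.
    by rewrite aM => sM; change (s \in iota 0 (a + 2).+1); rewrite mem_iota.
  by case: (nd r) => [[] ? ? ?|? ?] /=; ring.
- apply/matrixP=> z g; rewrite !mxE -[RHS](weight_closure_nodes w g).
  rewrite (big_nth (Joint 0 0)) size_nodes big_mkord.
  by apply: eq_bigr => r _; rewrite !mxE.
- by rewrite mxE [nd _](@nd_final 2).
- by move=> i j /(congr1 val) /= ij; apply: val_inj.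
- move=> i j /(congr1 val) /= /o_inj ij; apply: val_inj; apply: ij;
    exact: leqW.
by move=> r; rewrite -val_eqE /= neq_ltn ltn_ord.
Qed.

Let C : 'M[int]_(a + 2) := \matrix_(i, j) (fox_row (nd i) (o j)).[-1].

Let det_C : (\det closure_minor).[-1] = \det C.
Proof.
rewrite -[LHS]/(horner_eval _ _) -det_map_mx; congr determinant.
by apply/matrixP=> i j; rewrite !mxE.
Qed.

Let det_ulC : `|\det (ulsubmx C)|%N = 1%N.
Proof.
rewrite det_trig; last first.
  apply/is_trig_mxP => i j ij; rewrite !mxE /= /o !nd_word //.
  have /pairwiseP-/(_ (Joint 0 0) i j) := word_nodes_pairwise 0 w.
  rewrite !inE size_word_nodes => /(_ (ltn_ord _) (ltn_ord _) ij).
  by move/fox_row_notin->; rewrite horner0.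
apply: (big_ind (fun d : int => `|d|%N = 1%N)) => // [d e d1 e1|i _].
  by rewrite abszM d1 e1.
rewrite !mxE /= /o !nd_word //; apply: fox_row_out.
apply: (all_nthP _ (word_nodes_out_ins 0 w)); by rewrite size_word_nodes.
Qed.

(** Vanishing on [seg 0 2], the segment of the omitted column, lets the sum over the remaining
    columns compute the full linear form. *)
Let sum_colours_C r (c : nat -> int) : (r < (a + 2).+1)%N -> c (seg 0 2) = 0 ->
  \sum_(i < a + 2) (fox_row (nd r) (o i)).[-1] * c (o i) =
  (fox_coef (nd r) (fun s => (c s)%:P)).[-1].
Proof.
move=> rM c2; rewrite -fox_row_sum_out // big_ord_recr /= hornerD horner_sum.
rewrite hornerM hornerC [o (a + 2)%N]/o (@nd_final 2) //= c2 mulr0 addr0.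
by apply: eq_bigr => i _; rewrite hornerM hornerC.
Qed.

Lemma det_closure_minor : `|(\det closure_minor).[-1]|%N = `|2 - \tr (burau w)|%N.
Proof.
(* Top colours [(1, 0, 0)] and [(0, 1, 0)]: both vanish on the omitted segment and form the identity
   on the two remaining top segments. *)
have [c0 [c0w [c00 c01 c02] c0y]] := colouring_exists 0 w 1 0 0.
have [c1 [c1w [c10 c11 c12] c1y]] := colouring_exists 0 w 0 1 0.
pose c (q : 'I_2) := if q == 0 then c0 else c1.
have cw q : all (colours (c q)) (word_nodes 0 w) by rewrite /c; case: ifP.
have c2 q : c q (seg 0 2) = 0 by rewrite /c; case: ifP.
have c_final (p q : 'I_2) : c q (seg 0 p) = (p == q)%:R.
  by rewrite /c; case: p q => -[|[|//]] ? [[|[|//]] ?].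
pose P : 'M[int]_(a, 2) := \matrix_(i, q) c q (o i).
(* The letter relations kill both colourings, so only the defect of the final joints survives:
   bottom colour minus top colour. *)
pose K : 'M[int]_2 := \matrix_(p, q) (c q (seg N p) - (p == q)%:R).
have PE : col_mx P 1%:M = \matrix_(i < a + 2, q < 2) c q (o i).
  apply/matrixP=> i q; rewrite !mxE; case: split_ordP => k -> {i}; rewrite !mxE //=.
  by rewrite /o nd_final //= ?c_final // ltnS ltnW.
have CP : C *m col_mx P 1%:M = col_mx 0 K.
  rewrite PE; apply/matrixP=> i q; rewrite !mxE.
  under eq_bigr do rewrite !mxE.
  rewrite sum_colours_C //; last exact: leqW.
  case: split_ordP => k -> {i}; rewrite !mxE /=.
    rewrite nd_word //; apply: colours_fox_coef.
    by apply: (all_nthP _ (cw q)); rewrite size_word_nodes.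
  rewrite nd_final /=; last by rewrite ltnS ltnW.
  by rewrite hornerD hornerN !hornerC c_final.
rewrite det_C (det_col_elim CP) abszM det_ulC mul1n.
congr `|_|%N; rewrite det_mx2 !mxE /c /=.
have := det_burau w; rewrite det_mx2 /mxtrace !big_ord_recl big_ord0 addr0 /=.
have -> : lift ord0 ord0 = 1 :> 'I_2 by exact: val_inj.
case: c0y c1y; rewrite add0n -/N => e1 e2 e3 [e4 e5 e6].
(* The bottom colours are solved from their two differences and their alternating sum. Then [\det K]
   expands to [\det (burau w) - \tr (burau w) + 1]. *)
have -> : c0 (seg N 0) = 1 + burau w 1 0 by move: e3 e2; lia.
have -> : c0 (seg N 1) = 1 - burau w 0 0 + burau w 1 0 by move: e1 e2 e3; lia.
have -> : c1 (seg N 0) = - 1 - burau w 1 0 + burau w 1 1 by move: e4 e5 e6; lia.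
have -> : c1 (seg N 1) = - 1 + burau w 0 0 - burau w 0 1 - burau w 1 0 + burau w 1 1.
  by move: e4 e5 e6; lia.
rewrite -[burau w ord0 ord0]/(burau w 0 0).
by move: (burau w 0 0) (burau w 0 1) (burau w 1 0) (burau w 1 1) => p q r s; nia.
Qed.

End BraidClosure.

Lemma link_det_closure w : link_det (braid_closure w) = `|2 - \tr (burau w)|%N.
Proof. by rewrite (link_det_eval (is_alexander_closure w)) det_closure_minor. Qed.

(** * Powers, traces and the twisted weaving braid *)

Lemma burau_winv w : burau (winv w) = (burau w)^-1.
Proof.
have Uw : burau w \is a GRing.unit by rewrite unitmxE det_burau.
apply: (mulIr Uw); rewrite mulVr {Uw} //.
elim: w => [|x w IH]; first by rewrite mulr1.
rewrite /winv /= rev_cons -cats1 burau_cat /= mul1r -/(winv w).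
by rewrite -mulrA [burau _ * (_ * _)]mulrA IH mul1r burau_letterK.
Qed.

Lemma burau_wexp w z : burau (wexp w z) = burau w ^ z.
Proof.
have H v k : burau (flatten (nseq k v)) = burau v ^+ k.
  by elim: k => //= k IH; rewrite burau_cat IH exprSr.
by case: z => k; rewrite [LHS]H // burau_winv exprVn.
Qed.

(** By Cayley-Hamilton, [G * G = \tr G *: G - 1], so the traces of powers satisfy a two-term
    recursion. The sums [x ^+ n + y ^+ n] satisfy it too, since [x] and [y] have sum [\tr G] and
    product 1; two consecutive values are carried through the induction. *)
Lemma mxtrace_expr (F : comPzRingType) (G : 'M[int]_2) (x y : F) n :
  \det G = 1 -> x * y = 1 -> (\tr G)%:~R = x + y ->
  (\tr (G ^+ n))%:~R = x ^+ n + y ^+ n.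
Proof.
move=> detG xy trG.
have trS k : \tr (G ^+ k.+2) = \tr G * \tr (G ^+ k.+1) - \tr (G ^+ k).
  have GG : G * G = \tr G *: G - 1.
    move: detG; rewrite [G]mx2_eta det_mx2 !mxE tr_mx2 mx2M mx2_1 /=.
    move: (G 0 0) (G 0 1) (G 1 0) (G 1 1) => p q r s det1.
    by apply/matrixP=> -[[|[|//]] ?] -[[|[|//]] ?]; rewrite !mxE /=; nia.
  rewrite !exprS mulrA GG mulrBl mul1r -scalerAl.
  by rewrite linearB linearZ.
suff: (\tr (G ^+ n))%:~R = x ^+ n + y ^+ n /\ (\tr (G ^+ n.+1))%:~R = x ^+ n.+1 + y ^+ n.+1.
  by case.
elim: n => [|n [IH0 IH1]].
  by rewrite expr0 mxtrace1 !expr1.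
split=> //; rewrite trS rmorphB rmorphM /= IH0 IH1 trG.
rewrite !exprS; transitivity (x * (x * x ^+ n) + y * (y * y ^+ n)
                          + (x * y - 1) * (x ^+ n + y ^+ n)).
  ring.
by rewrite xy subrr mul0r addr0.
Qed.

Lemma burau_weaving m1 m2 n l :
  burau (twisted_hybrid_weaving_braid m1%:Z (- m2%:Z) n l) =
  (-1) ^ l *: mx2 (1 + m1%:Z * m2%:Z) m2 m1 1 ^+ n.
Proof.
have s1 k : mx2 1 0 1 1 ^+ k = mx2 1 0 k 1.
  elim: k => [|k IH]; first by rewrite -mx2_1.
  by rewrite exprS IH mx2M; congr mx2; lia.
have s2 k : mx2 1 1 0 1 ^+ k = mx2 1 k 0 1.
  elim: k => [|k IH]; first by rewrite -mx2_1.
  by rewrite exprS IH mx2M; congr mx2; lia.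
have s2V : (mx2 1 (-1) 0 1)^-1 = mx2 1 1 0 1.
  have /= := burau_winv (gen sigma2); rewrite !mul1r => <- //.
rewrite /twisted_hybrid_weaving_braid burau_cat !burau_wexp !burau_cat !burau_wexp /=.
rewrite !mul1r -exprz_exp.
(* The full twist acts as -1, whence the factor [(-1) ^ l]. *)
have -> : (mx2 1 (-1) 0 1 * mx2 1 0 1 1) ^ 3%:Z = (-1)%:M.
  by rewrite mx2_scalar -exprnP !exprS expr0 mulr1 !mx2M.
have -> : (-1)%:M ^ l = ((-1) ^ l)%:M :> 'M[int]_2.
  by rewrite [RHS](rmorphXz (scalar_mx (n := 2))).
rewrite [LHS]mul_scalar_mx -exprz_inv s2V -!exprnP s1 s2 mx2M.
by congr (_ *: mx2 _ _ _ _ ^+ _); ring.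
Qed.

Theorem theorem2 (R : realType) (m1 m2 n : nat) (l : int) (beta : braid_word)
    (m1_gt0 : (0 < m1)%N) (m2_gt0 : (0 < m2)%N) (n_gt0 : (0 < n)%N)
    (beta_def :
       braid_eq beta (twisted_hybrid_weaving_braid m1%:Z (- m2%:Z) n l)) :
  (link_det (braid_closure beta))%:R =
  `| ((2 + m1%:R * m2%:R
         + Num.sqrt (m1%:R ^+ 2 * m2%:R ^+ 2 + 4 * m1%:R * m2%:R)) / 2) ^+ n
   + ((2 + m1%:R * m2%:R
         - Num.sqrt (m1%:R ^+ 2 * m2%:R ^+ 2 + 4 * m1%:R * m2%:R)) / 2) ^+ n
   + (-1) ^ (l + 1) * 2 | :> R.

Proof.
rewrite link_det_closure (burau_eq beta_def) burau_weaving mxtraceZ.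
set b : R := m1%:R * m2%:R; set s := Num.sqrt _.
have b0 : 0 <= b by rewrite mulr_ge0 ?ler0n.
have s2 : s ^+ 2 = b ^+ 2 + 4 * b.
  rewrite sqr_sqrtr; first by rewrite /b; ring.
  by rewrite -exprMn -mulrA addr_ge0 ?sqr_ge0 // mulr_ge0.
have det1 : \det (mx2 (1 + m1%:Z * m2%:Z) m2 m1 1) = 1.
  by rewrite det_mx2 !mxE /=; ring.
(* The two bases have product 1 and sum [2 + b]: they are the eigenvalues of the matrix of one
   period. *)
have xy : (2 + b + s) / 2 * ((2 + b - s) / 2) = 1.
  transitivity (((2 + b) ^+ 2 - s ^+ 2) / 4); first by field.
  by rewrite s2; field.
have tr : (\tr (mx2 (1 + m1%:Z * m2%:Z) m2 m1 1))%:~R = (2 + b + s) / 2 + (2 + b - s) / 2.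
  by rewrite tr_mx2 !rmorphD rmorphM /= -/b; field.
rewrite natr_absz intr_norm rmorphB rmorphM /= (mxtrace_expr n det1 xy tr).
rewrite expfzDr ?oppr_eq0 ?oner_eq0 // expr1z [(-1 : int) ^ l]expN1r expN1r.
rewrite -[in LHS]signr_odd -[in RHS]signr_odd.
(* For odd [l] both sides contain the trace plus 2; for even [l] they are 2 minus the trace and its
   opposite, equal in absolute value. *)
case: odd; rewrite ?expr0 ?expr1; last by rewrite -normrN; congr `|_|; ring.
by congr `|_|; ring.
Qed.
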